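(* Let $a,b\in\mathbb{R}^4$, $\alpha\in\mathbb{R}\setminus\{0\}$, $A\in O(4)$, $\varepsilon\in\{0,2\}$, and consider the Möbius transformation $$\phi(x)=a+\frac{\alpha A(x-b)}{|x-b|^{\varepsilon}},$$ defined on $\mathbb{R}^4$ if $\varepsilon=0$ and on $\mathbb{R}^4\setminus\{b\}$ if $\varepsilon=2$. Viewed as a map from its domain endowed with the spherical metric $g_S=\frac{4\,dx^2}{(1+|x|^2)^2}$ into $\mathbb{R}^4$ with the Euclidean metric $dx^2$, $\phi$ is not biharmonic; that is, none of the Möbius transformations of this form is biharmonic with respect to these metrics.
   Context: For a smooth map $\phi:(M,g)\to(N,h)$ between Riemannian manifolds, the tension field is $\tau(\phi)=\mathrm{Tr}_g\nabla d\phi$. The map $\phi$ is biharmonic if $$-\mathrm{Tr}_g(\nabla^\phi)^2\tau(\phi)-\mathrm{Tr}_g R^N(\tau(\phi),d\phi)d\phi=0,$$ where $\nabla^\phi$ is the pull-back connection on $\phi^{-1}TN$ and $R^N$ is the Riemannian curvature of $N$ with the convention $R(X,Y)Z=\nabla_X\nabla_YZ-\nabla_Y\nabla_XZ-\nabla_{[X,Y]}Z$. *)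

(* Defs.v *)
From mathcomp Require Import all_boot all_order all_algebra.
From mathcomp Require Import all_classical all_reals all_analysis.
Set Implicit Arguments.
Unset Strict Implicit.
Unset Printing Implicit Defensive.
Import Order.TTheory GRing.Theory Num.Theory.
Import numFieldNormedType.Exports.
Local Open Scope classical_set_scope.
Local Open Scope ring_scope.

(* Riemannian geometry on open subsets of R^n in the standard global chart:
   tangent spaces are identified with 'cV[R]_n, vector fields (and sections of
   a pull-back bundle) are functions into 'cV[R]_n, and a metric g is given by
   its Gram matrix, g x i j = g_x(e_i, e_j).  Dimensions have the form n.+1
   because 'cV[R]_n is a normedModType only then.  Derivatives are total
   functions, meaningful where the argument is differentiable; 'D_v f x only
   depends on f near x, so what f does outside an open domain is irrelevant
   on that domain. *)

Section Geometry.
Variable R : realType.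

Definition metric (n : nat) := 'cV[R]_n.+1 -> 'M[R]_n.+1.

Definition frame (n : nat) (i : 'I_n.+1) : 'cV[R]_n.+1 := delta_mx i 0.

Definition pd (n : nat) (i : 'I_n.+1) (f : 'cV[R]_n.+1 -> R)
    (x : 'cV[R]_n.+1) : R :=
  'D_(frame i) f x.

(* christoffel g x k i j is Gamma^k_{ij} of the Levi-Civita connection of g. *)
Definition christoffel (n : nat) (g : metric n) (x : 'cV[R]_n.+1)
    (k i j : 'I_n.+1) : R :=
  2^-1 * \sum_l invmx (g x) k l *
    (pd i (fun y => g y j l) x + pd j (fun y => g y i l) x
     - pd l (fun y => g y i j) x).

Definition Gamma (n : nat) (g : metric n) (x u v : 'cV[R]_n.+1) :
    'cV[R]_n.+1 :=
  \col_k \sum_i \sum_j christoffel g x k i j * u i 0 * v j 0.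

Definition nabla (n : nat) (g : metric n) (X Y : 'cV[R]_n.+1 -> 'cV[R]_n.+1)
    (x : 'cV[R]_n.+1) : 'cV[R]_n.+1 :=
  'D_(X x) Y x + Gamma g x (X x) (Y x).

Definition lie_bracket (n : nat) (X Y : 'cV[R]_n.+1 -> 'cV[R]_n.+1)
    (x : 'cV[R]_n.+1) : 'cV[R]_n.+1 :=
  'D_(X x) Y x - 'D_(Y x) X x.

Definition curvature (n : nat) (g : metric n)
    (X Y Z : 'cV[R]_n.+1 -> 'cV[R]_n.+1) (x : 'cV[R]_n.+1) : 'cV[R]_n.+1 :=
  nabla g X (nabla g Y Z) x - nabla g Y (nabla g X Z) x
  - nabla g (lie_bracket X Y) Z x.

(* The curvature is tensorial, so its value on tangent vectors u, v, w at x may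
   be computed with the constant vector fields extending them. *)
Definition curvature_at (n : nat) (g : metric n) (x u v w : 'cV[R]_n.+1) :
    'cV[R]_n.+1 :=
  curvature g (fun _ => u) (fun _ => v) (fun _ => w) x.

(* Trace with respect to g_x of the bilinear form with B i j = B(e_i, e_j). *)
Definition trace_g (m n : nat) (g : metric m) (x : 'cV[R]_m.+1)
    (B : 'I_m.+1 -> 'I_m.+1 -> 'cV[R]_n.+1) : 'cV[R]_n.+1 :=
  \sum_i \sum_j invmx (g x) i j *: B i j.

Section Maps.
Variables (m n : nat) (g : metric m) (h : metric n).
Variable phi : 'cV[R]_m.+1 -> 'cV[R]_n.+1.

(* V is a section of phi^{-1}TN, that is, V x is a tangent vector at phi x. *)
Definition pullback_nabla (v : 'cV[R]_m.+1) (V : 'cV[R]_m.+1 -> 'cV[R]_n.+1)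
    (x : 'cV[R]_m.+1) : 'cV[R]_n.+1 :=
  'D_v V x + Gamma h (phi x) ('D_v phi x) (V x).

(* (nabla d phi)(e_i, e_j), where nabla_{e_i} e_j = Gamma g (e_i) (e_j). *)
Definition second_fundamental_form (x : 'cV[R]_m.+1) (i j : 'I_m.+1) :
    'cV[R]_n.+1 :=
  pullback_nabla (frame i) (fun y => 'D_(frame j) phi y) x
  - 'D_(Gamma g x (frame i) (frame j)) phi x.

Definition tension (x : 'cV[R]_m.+1) : 'cV[R]_n.+1 :=
  trace_g g x (second_fundamental_form x).

(* (nabla^phi)^2_{X,Y} V = nabla_X nabla_Y V - nabla_{nabla_X Y} V
   at X = e_i, Y = e_j. *)
Definition pullback_nabla2 (V : 'cV[R]_m.+1 -> 'cV[R]_n.+1)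
    (x : 'cV[R]_m.+1) (i j : 'I_m.+1) : 'cV[R]_n.+1 :=
  pullback_nabla (frame i) (pullback_nabla (frame j) V) x
  - pullback_nabla (Gamma g x (frame i) (frame j)) V x.

Definition bitension (x : 'cV[R]_m.+1) : 'cV[R]_n.+1 :=
  - trace_g g x (pullback_nabla2 tension x)
  - trace_g g x (fun i j =>
      curvature_at h (phi x) (tension x)
        ('D_(frame i) phi x) ('D_(frame j) phi x)).

(* Intended for D open and phi smooth on D. *)
Definition biharmonic_on (D : set 'cV[R]_m.+1) : Prop :=
  forall x, D x -> bitension x = 0.

End Maps.

(* The norm `|x| of the library on matrices is the sup norm. *)
Definition enorm (n : nat) (x : 'cV[R]_n.+1) : R :=
  Num.sqrt (\sum_i x i 0 ^+ 2).

Definition euclidean_metric (n : nat) : metric n := fun _ => 1%:M.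

Definition spherical_metric (n : nat) : metric n :=
  fun x => (4 / (1 + enorm x ^+ 2) ^+ 2)%:M.

Definition orthogonal_mx (n : nat) (A : 'M[R]_n) : Prop := A^T *m A = 1%:M.

Definition moebius (n : nat) (a b : 'cV[R]_n.+1) (alpha : R)
    (A : 'M[R]_n.+1) (eps : nat) (x : 'cV[R]_n.+1) : 'cV[R]_n.+1 :=
  a + (enorm (x - b) ^+ eps)^-1 *: (alpha *: (A *m (x - b))).

Definition moebius_domain (n : nat) (b : 'cV[R]_n.+1) (eps : nat) :
    set 'cV[R]_n.+1 :=
  if eps == 0%N then setT else ~` [set b].

End Geometry.

Arguments euclidean_metric : clear implicits.
Arguments spherical_metric : clear implicits.

(* Main.v *)
(* For a Euclidean target the tension and the bitension field are, up to sign,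
   the first and second iterate of the Laplacian of the metric [4 dx^2 / s^2], [s = 1 + |x|^2],
   acting on each component; in dimension 4 it is [s^2/4 Lap V - s dV(x)].
   Two facts give the result.  The Laplacian of the Moebius map is [- s W] with
   [W] Euclidean-harmonic, and for every harmonic [W] the Laplacian of [s W] is
   [2 s W].  Hence the bitension field is [2 s W], which would have to vanish
   identically; evaluating at points at distance 1 from the pole [b] (or away
   from the origin in the affine case) shows that it does not. *)
Require Import Defs.
From mathcomp Require Import all_boot all_order all_algebra.
From mathcomp Require Import all_classical all_reals all_analysis.
From mathcomp Require Import ring.
Set Implicit Arguments.
Unset Strict Implicit.
Unset Printing Implicit Defensive.
Import Order.TTheory GRing.Theory Num.Theory.
Import numFieldNormedType.Exports.
Local Open Scope classical_set_scope.
Local Open Scope ring_scope.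

(** * Derivatives of matrix-valued maps *)

Section MatrixDerivatives.
Context {R : realType} {V : normedModType R}.
Implicit Types (x v : V).

Lemma is_derive_mxP {m n : nat} (F : V -> 'M[R]_(m.+1, n.+1))
    (dF : 'M[R]_(m.+1, n.+1)) x v :
  is_derive x v F dF <->
  forall i j, is_derive x v (fun y => F y i j) (dF i j).
Proof.
split=> [[dvF <-] i j|dvF].
  split; first exact: (derivable_mxP F x v).1.
  by rewrite derive_mx// mxE.
have F' : derivable F x v.
  by apply/derivable_mxP => i j; case: (dvF i j).
split=> //; rewrite derive_mx//; apply/matrixP => i j; rewrite mxE.
by case: (dvF i j).
Qed.

Lemma is_derive_scale {m n : nat} (f : V -> R) (F : V -> 'M[R]_(m.+1, n.+1))
    (df : R) (dF : 'M[R]_(m.+1, n.+1)) x v :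
  is_derive x v f df -> is_derive x v F dF ->
  is_derive x v (fun y => f y *: F y) (df *: F x + f x *: dF).
Proof.
move=> f' /is_derive_mxP F'; apply/is_derive_mxP => i j.
rewrite (_ : (fun y => _) = f * (fun y => F y i j)); last first.
  by apply/funext => y; rewrite mxE.
have := is_deriveM f' (F' i j); move/is_derive_eq; apply.
by rewrite !mxE /GRing.scale /=; ring.
Qed.

Lemma is_derive_mulmx {m n p : nat} (A : 'M[R]_(m.+1, n.+1))
    (F : V -> 'M[R]_(n.+1, p.+1)) (dF : 'M[R]_(n.+1, p.+1)) x v :
  is_derive x v F dF -> is_derive x v (fun y => A *m F y) (A *m dF).
Proof.
move=> /is_derive_mxP F'; apply/is_derive_mxP => i j.
rewrite (_ : (fun y => _) = \sum_k (A i k \*: (fun y => F y k j))); last first.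
  by apply/funext => y; rewrite mxE fct_sumE.
rewrite mxE; apply: is_derive_sum => k; exact: is_deriveZ.
Qed.

(** Formulas valid off the pole then hold on a whole neighbourhood, as second derivatives
    require. *)
Lemma near_neq (x b : V) : x != b -> \forall y \near x, y != b.
Proof.
move=> xb; have ob : open (~` [set b]).
  exact/closed_openC/accessible_closed_set1/hausdorff_accessible/norm_hausdorff.
have : nbhs x (~` [set b]) by apply: open_nbhs_nbhs; split=> //; exact/eqP.
by apply: filterS => y /eqP.
Qed.

End MatrixDerivatives.

(** * The Euclidean inner product and derivatives of radial functions *)

Section Euclidean.
Context {R : realType} {n : nat}.
Implicit Types (x u v w b : 'cV[R]_n.+1).

Definition dot u v : R := \sum_i u i 0 * v i 0.

Lemma dotC u v : dot u v = dot v u.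
Proof. by apply: eq_bigr => i _; rewrite mulrC. Qed.

Lemma trmx_mul_dot u v : u^T *m v = (dot u v)%:M.
Proof.
apply/matrixP => i j; rewrite !ord1 !mxE mulr1n.
by apply: eq_bigr => k _; rewrite mxE.
Qed.

(** Differentiating the scalar factor of a product [f y *: W y] with radial [f] contributes such a
    rank-one matrix to the Jacobian. *)
Lemma mulmx_outer {m : nat} (u : 'cV[R]_m) x v : u *m x^T *m v = dot x v *: u.
Proof. by rewrite -mulmxA trmx_mul_dot mul_mx_scalar. Qed.

Lemma dotDl u v w : dot (u + v) w = dot u w + dot v w.
Proof.
by rewrite /dot -big_split; apply: eq_bigr => i _; rewrite mxE mulrDl.
Qed.

Lemma dotDr u v w : dot u (v + w) = dot u v + dot u w.
Proof. by rewrite !(dotC u) dotDl. Qed.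

Lemma dot_frame u (i : 'I_n.+1) : dot u (frame R i) = u i 0.
Proof.
rewrite /dot (bigD1 i)//= big1 ?addr0 => [|j ji].
  by rewrite mxE !eqxx mulr1.
by rewrite mxE (negPf ji) mulr0.
Qed.

Lemma sum_frame u : \sum_i u i 0 *: frame R i = u.
Proof.
apply/colP => k; rewrite summxE (bigD1 k)//= big1 ?addr0 => [|j jk].
  by rewrite !mxE !eqxx mulr1.
by rewrite !mxE eq_sym (negPf jk) mulr0.
Qed.

Lemma dot_self_ge0 u : 0 <= dot u u.
Proof. by apply: sumr_ge0 => i _; rewrite -expr2; exact: sqr_ge0. Qed.

Lemma dot_self_eq0 u : (dot u u == 0) = (u == 0).
Proof.
rewrite psumr_eq0 => [|i _]; last by rewrite -expr2; exact: sqr_ge0.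
apply/allP/eqP => [u0|-> i _]; last by rewrite /= mxE mulr0 eqxx.
apply/colP => i; rewrite mxE; apply/eqP.
by have := u0 i (mem_index_enum i); rewrite /= mulf_eq0 orbb.
Qed.

Lemma enorm_sqr u : enorm u ^+ 2 = dot u u.
Proof. by rewrite sqr_sqrtr ?dot_self_ge0. Qed.

Lemma is_derive_dot (F G : 'cV[R]_n.+1 -> 'cV[R]_n.+1) dF dG x v :
  is_derive x v F dF -> is_derive x v G dG ->
  is_derive x v (fun y => dot (F y) (G y)) (dot dF (G x) + dot (F x) dG).
Proof.
move=> /is_derive_mxP F' /is_derive_mxP G'.
rewrite (_ : (fun y => _) =
    \sum_i ((fun y => F y i 0) * (fun y => G y i 0))); last first.
  by apply/funext => y; rewrite fct_sumE.
apply: is_derive_eq; rewrite -big_split; apply: eq_bigr => i _ /=.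
by rewrite /GRing.scale /=; ring.
Qed.

Definition rsq b x : R := dot (x - b) (x - b).

Lemma rsq_neq0 b x : x != b -> rsq b x != 0.
Proof. by rewrite dot_self_eq0 subr_eq0. Qed.

Lemma is_derive_subr b x v : is_derive x v (fun y => y - b) v.
Proof.
have -> : (fun y : 'cV[R]_n.+1 => y - b) = id - cst b by apply/funext.
by apply: is_derive_eq; rewrite subr0.
Qed.

Lemma is_derive_rsq b x v : is_derive x v (rsq b) (2 * dot (x - b) v).
Proof.
have dy := is_derive_subr b x v.
apply: (is_derive_eq (is_derive_dot dy dy)).
by rewrite (dotC v); ring.
Qed.

Lemma is_derive_rsqVX b (p : nat) x v : x != b ->
  is_derive x v (fun y => (rsq b y)^-1 ^+ p)
    (- 2 * p%:R * (rsq b x)^-1 ^+ p.+1 * dot (x - b) v).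
Proof.
move=> xb.
have dV : is_derive x v (fun y => (rsq b y)^-1)
    (- 2 * (rsq b x)^-1 ^+ 2 * dot (x - b) v).
  have [dr er] := is_derive_rsq b x v.
  split; first by apply: derivableV => //; exact: rsq_neq0.
  rewrite deriveV ?rsq_neq0// er /GRing.scale /= exprVn; ring.
have -> : (fun y => (rsq b y)^-1 ^+ p) = (fun y => (rsq b y)^-1) ^+ p.
  by apply/funext => y; rewrite exprfctE.
apply: (is_derive_eq (is_deriveX p dV)).
(* The case [p = 0], where the predecessor exponent is truncated, is separate: both sides carry the
   factor 0. *)
case: p => [|p] /=; first by rewrite !mul0r !(mulr0, mul0r, scale0r).
rewrite /GRing.scale /= !exprS; ring.
Qed.

Definition sph x : R := 1 + dot x x.

Lemma sph_gt0 x : 0 < sph x.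
Proof. by rewrite ltr_pwDl// dot_self_ge0. Qed.

Lemma sph_neq0 x : sph x != 0.
Proof. by rewrite gt_eqF ?sph_gt0. Qed.

Lemma is_derive_sph x v : is_derive x v sph (2 * dot x v).
Proof.
have -> : sph = cst 1 + (fun y => dot (id y) (id y)) by apply/funext.
have d := is_derive_dot (is_derive_id x v) (is_derive_id x v).
apply: is_derive_eq; rewrite add0r /= dotC; ring.
Qed.

End Euclidean.

(** * The flat target *)

Section EuclideanMetric.
Context {R : realType} {n : nat}.
Implicit Types (x : 'cV[R]_n.+1).

Lemma christoffel_euclidean x k i j :
  christoffel (euclidean_metric R n) x k i j = 0.
Proof.
rewrite /christoffel big1 ?mulr0// => l _.
by rewrite /pd !derive_cst; ring.
Qed.

Lemma Gamma_euclidean x u v : Gamma (euclidean_metric R n) x u v = 0.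
Proof.
apply/colP => k; rewrite !mxE big1// => i _; rewrite big1// => j _.
by rewrite christoffel_euclidean !mul0r.
Qed.

(** [curvature_at] extends vectors by constant fields; these are parallel, and the resulting zero
    field is again constant. *)
Lemma curvature_euclidean x u v w :
  curvature_at (euclidean_metric R n) x u v w = 0.
Proof.
have nabla_cst X (Z : 'cV[R]_n.+1) :
    nabla (euclidean_metric R n) X (fun=> Z) = fun=> 0.
  by apply/funext => y; rewrite /nabla Gamma_euclidean derive_cst addr0.
by rewrite /curvature_at /curvature !nabla_cst !subr0.
Qed.

Lemma pullback_nabla_euclidean {m : nat} (phi : 'cV[R]_m.+1 -> 'cV[R]_n.+1) v V :
  pullback_nabla (euclidean_metric R n) phi v V = 'D_v V.
Proof.
by apply/funext => x; rewrite /pullback_nabla Gamma_euclidean addr0.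
Qed.

End EuclideanMetric.

(** * Connection and Laplacian of the spherical metric *)

Section SphericalMetric.
Context {R : realType} {n : nat}.
Implicit Types (x : 'cV[R]_n.+1).

Lemma spherical_metricE x : spherical_metric R n x = (4 / sph x ^+ 2)%:M.
Proof. by rewrite /spherical_metric enorm_sqr. Qed.

Lemma invmx_spherical_metric x :
  invmx (spherical_metric R n x) = (sph x ^+ 2 / 4)%:M.
Proof. by rewrite spherical_metricE invmx_scalar invf_div. Qed.

Lemma pd_spherical_metric x (i j l : 'I_n.+1) :
  pd i (fun y => spherical_metric R n y j l) x =
  - 16 * x i 0 / sph x ^+ 3 * (j == l)%:R.
Proof.
rewrite /pd (_ : (fun y => _) = (4 * (j == l)%:R) \*: (fun y => (sph y)^-1) ^+ 2).
  have [d2 e2] := is_derive_sph x (frame R i).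
  have dV : is_derive x (frame R i) (fun y => (sph y)^-1) (- sph x ^- 2 * (2 * x i 0)).
    split; first by apply: derivableV => //; exact: sph_neq0.
    by rewrite deriveV ?sph_neq0// e2 dot_frame.
  rewrite derive_val /GRing.scale /=; field; exact: sph_neq0.
apply/funext => y; rewrite spherical_metricE !mxE.
by rewrite -exprVn exprfctE -[LHS]mulr_natr -[RHS]/(_ * _); ring.
Qed.

(** This is the formula for a conformal metric [e^(2f) dx^2], with [f = log (2 / sph)] and
    [d_i f = - 2 x_i / sph]. The inverse metric is scalar, so only [l = k] survives. *)
Lemma christoffel_spherical x (k i j : 'I_n.+1) :
  christoffel (spherical_metric R n) x k i j =
  - 2 / sph x * (x i 0 * (j == k)%:R + x j 0 * (i == k)%:R - x k 0 * (i == j)%:R).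
Proof.
rewrite /christoffel invmx_spherical_metric (bigD1 k)//= big1 => [|l lk].
  rewrite !pd_spherical_metric mxE eqxx mulr1n; field; exact: sph_neq0.
by rewrite mxE eq_sym (negPf lk) mul0r.
Qed.

Lemma Gamma_frame (g : metric R n) x (i j : 'I_n.+1) :
  Gamma g x (frame R i) (frame R j) = \col_k christoffel g x k i j.
Proof.
apply/colP => k; rewrite !mxE (bigD1 i)//= [X in _ + X]big1 ?addr0.
  rewrite (bigD1 j)//= big1 ?addr0 => [|l lj]; first by rewrite !mxE !eqxx !mulr1.
  by rewrite [frame R j l 0]mxE (negPf lj) mulr0.
move=> l li; apply: big1 => q _.
by rewrite [frame R i l 0]mxE (negPf li) mulr0 mul0r.
Qed.

Lemma Gamma_spherical_frame x (i : 'I_n.+1) :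
  Gamma (spherical_metric R n) x (frame R i) (frame R i) =
  (2 / sph x) *: (x - 2 *: (x i 0 *: frame R i)).
Proof.
rewrite Gamma_frame; apply/colP => k; rewrite !mxE christoffel_spherical eqxx.
by rewrite (eq_sym i) andbT mulr1n; ring.
Qed.

(** The Laplace-Beltrami operator, as the trace of the Hessian. Left unsimplified, it matches both
    the tension field and the rough Laplacian of sections. *)
Definition spherical_laplacian {m : nat} (V : 'cV[R]_n.+1 -> 'cV[R]_m.+1) x :
    'cV[R]_m.+1 :=
  (sph x ^+ 2 / 4) *: \sum_i ('D_(frame R i) ('D_(frame R i) V) x
     - 'D_((2 / sph x) *: (x - 2 *: (x i 0 *: frame R i))) V x).

Lemma trace_g_spherical {m : nat} x (B : 'I_n.+1 -> 'I_n.+1 -> 'cV[R]_m.+1) :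
  trace_g (spherical_metric R n) x B = (sph x ^+ 2 / 4) *: \sum_i B i i.
Proof.
rewrite /trace_g scaler_sumr; apply: eq_bigr => i _.
rewrite (bigD1 i)//= big1 ?addr0 => [|j ji].
  by rewrite invmx_spherical_metric mxE eqxx mulr1n.
by rewrite invmx_spherical_metric mxE eq_sym (negPf ji) scale0r.
Qed.

Lemma tension_spherical_euclidean {m : nat} (phi : 'cV[R]_n.+1 -> 'cV[R]_m.+1) :
  tension (spherical_metric R n) (euclidean_metric R m) phi =
  spherical_laplacian phi.
Proof.
apply/funext => x; rewrite /tension trace_g_spherical /spherical_laplacian.
apply: (congr1 ( *:%R _)); apply: eq_bigr => i _.
by rewrite /second_fundamental_form pullback_nabla_euclidean Gamma_spherical_frame.
Qed.

(** A flat target kills the curvature term and makes the rough Laplacian of sections the same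
    operator as the one giving the tension. *)
Lemma bitension_spherical_euclidean {m : nat} (phi : 'cV[R]_n.+1 -> 'cV[R]_m.+1) x :
  bitension (spherical_metric R n) (euclidean_metric R m) phi x =
  - spherical_laplacian (spherical_laplacian phi) x.
Proof.
rewrite /bitension tension_spherical_euclidean !trace_g_spherical.
rewrite [X in _ - _ *: X]big1 => [|i _]; last exact: curvature_euclidean.
rewrite scaler0 subr0; apply: (congr1 (fun u => - (_ *: u))); apply: eq_bigr => i _.
by rewrite /pullback_nabla2 !pullback_nabla_euclidean Gamma_spherical_frame.
Qed.

End SphericalMetric.

(** * Laplacian calculus in dimension 4 *)

Section Laplacian4.
Context {R : realType} {m : nat}.
Implicit Types (x b : 'cV[R]_4) (V : 'cV[R]_4 -> 'cV[R]_m.+1)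
  (J : 'cV[R]_4 -> 'M[R]_(m.+1, 4)).

(* [J] is the Jacobian of [V] near [x] and [L] is the Euclidean Laplacian of [V]
   at [x]. *)
Definition has_laplacian V J (L : 'cV[R]_m.+1) x :=
  (\forall y \near x, forall v, is_derive y v V (J y *m v)) /\
  exists H : 'I_4 -> 'cV[R]_m.+1,
    (forall i, is_derive x (frame R i) (fun y => J y *m frame R i) (H i)) /\
    \sum_i H i = L.

Lemma has_laplacianD V V' J J' L L' x :
  has_laplacian V J L x -> has_laplacian V' J' L' x ->
  has_laplacian (fun y => V y + V' y) (fun y => J y + J' y) (L + L') x.
Proof.
move=> [dV [H [dJ <-]]] [dV' [H' [dJ' <-]]]; split.
  near=> y => v; rewrite mulmxDl; apply: is_deriveD.
    by move: v; near: y.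
  by move: v; near: y.
exists (fun i => H i + H' i); split; last by rewrite big_split.
move=> i; have -> : (fun y => (J y + J' y) *m frame R i) =
    (fun y => J y *m frame R i) + (fun y => J' y *m frame R i).
  by apply/funext => y; rewrite mulmxDl.
exact: is_deriveD.
Unshelve. all: by end_near. Qed.

Lemma has_laplacianN V J L x :
  has_laplacian V J L x ->
  has_laplacian (fun y => - V y) (fun y => - J y) (- L) x.
Proof.
move=> [dV [H [dJ <-]]]; split.
  near=> y => v; rewrite mulNmx; apply: is_deriveN.
  by move: v; near: y.
exists (fun i => - H i); split; last by rewrite sumrN.
move=> i; have -> : (fun y => - J y *m frame R i) = - (fun y => J y *m frame R i).
  by apply/funext => y; rewrite mulNmx.
exact: is_deriveN.
Unshelve. all: by end_near. Qed.

(** The vectors [(2 / s) (x - 2 x_i e_i)] sum to [(2 / s) (4 - 2) x = 4 x / s], which the factor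
    [s^2 / 4] turns into [s x]. *)
Lemma spherical_laplacianE V J L x : has_laplacian V J L x ->
  spherical_laplacian V x = (sph x ^+ 2 / 4) *: L - sph x *: (J x *m x).
Proof.
move=> [dV [H [dJ <-]]].
have D1 v : 'D_v V x = J x *m v.
  by have /(_ v) dVx := nbhs_singleton dV; rewrite derive_val.
have D2 i : 'D_(frame R i) ('D_(frame R i) V) x = H i.
  have [_ <-] := dJ i; apply: near_eq_derive; near=> y.
  have dVy : forall v, is_derive y v V (J y *m v) by near: y.
  by have := dVy (frame R i); rewrite derive_val.
rewrite /spherical_laplacian.
under eq_bigr do rewrite D2 D1.
rewrite sumrB scalerBr; congr (_ - _).
rewrite -mulmx_sumr -scaler_sumr sumrB -scaler_sumr sum_frame.
rewrite sumr_const card_ord -[x *+ 4]scaler_nat -scalerBl scalerA.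
rewrite -scalemxAr scalerA; congr (_ *: _); field; exact: sph_neq0.
Unshelve. all: by end_near. Qed.

(** Locality lets the operator be applied a second time to a tension field whose closed form is
    established only off the pole. *)
Lemma spherical_laplacian_near V V' x : {near x, V =1 V'} ->
  spherical_laplacian V x = spherical_laplacian V' x.
Proof.
move=> VV'; rewrite /spherical_laplacian; apply: (congr1 ( *:%R _)).
apply: eq_bigr => i _; rewrite (near_eq_derive _ VV').
have VV'2 : \forall y \near x, {near y, V =1 V'} by apply: near_join.
have DVV' : {near x, 'D_(frame R i) V =1 'D_(frame R i) V'}.
  by near=> y; apply: near_eq_derive; near: y.
by rewrite (near_eq_derive _ DVV').
Unshelve. all: by end_near. Qed.

(** By Leibniz, the Euclidean Laplacian of [s W] is [8 W + 4 dW(x)] and its derivative along [x] is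
    [2 |x|^2 W + s dW(x)]. The terms in [dW(x)] cancel, leaving
    [2 s^2 W - 2 s (s - 1) W = 2 s W]. *)
Lemma spherical_laplacian_sph_harmonic W J x : has_laplacian W J 0 x ->
  spherical_laplacian (fun y => sph y *: W y) x = (2 * sph x) *: W x.
Proof.
move=> [dW [H [dJ H0]]].
pose J' y := 2 *: (W y *m y^T) + sph y *: J y.
have J'E y v : J' y *m v = (2 * dot y v) *: W y + sph y *: (J y *m v).
  by rewrite mulmxDl -2!scalemxAl mulmx_outer scalerA.
have -> : spherical_laplacian (fun y => sph y *: W y) x =
  (sph x ^+ 2 / 4) *: (8 *: W x + 4 *: (J x *m x)) - sph x *: (J' x *m x).
  apply: spherical_laplacianE; split.
    near=> y => v; rewrite J'E.
    by apply: is_derive_scale; [exact: is_derive_sph|move: v; near: y].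
  exists (fun i => 2 *: W x + (2 * x i 0) *: (J x *m frame R i)
                 + ((2 * x i 0) *: (J x *m frame R i) + sph x *: H i)); split.
    move=> i.
    have -> : (fun y => J' y *m frame R i) =
        (fun y : 'cV[R]_4 => (2 * y i 0) *: W y) + (fun y => sph y *: (J y *m frame R i)).
      by apply/funext => y; rewrite J'E dot_frame.
    apply: is_deriveD; last first.
      by rewrite -(dot_frame x); apply: is_derive_scale; exact: is_derive_sph.
    apply: is_derive_scale; last exact: (nbhs_singleton dW).
    have /is_derive_mxP/(_ i 0) dx := is_derive_id x (frame R i).
    have d2x := is_deriveZ 2 dx.
    apply: (is_derive_eq d2x).
    by rewrite mxE !eqxx /GRing.scale /= mulr1.
  rewrite !big_split /= -[X in _ + (_ + X)]scaler_sumr H0 scaler0 addr0.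
  rewrite sumr_const card_ord -addrA -mulr2n -[_ *+ 4]scaler_nat scalerA -natrM.
  congr (_ + _).
  under eq_bigr do rewrite -scalerA scalemxAr.
  by rewrite -scaler_sumr -mulmx_sumr sum_frame -scaler_nat scalerA -natrM.
have dxx : dot x x = sph x - 1 by rewrite /sph; ring.
rewrite J'E dxx; apply/colP => k; rewrite !mxE.
by field.
Unshelve. all: by end_near. Qed.

(* [p = 0] covers the affine maps and, with [K = 0], the constants. *)
Lemma has_laplacian_inversion b (p : nat) (K : 'M[R]_(m.+1, 4))
    (u : 'cV[R]_m.+1) x : x != b ->
  let h y := (rsq b y)^-1 in
  let G y := K *m (y - b) + u in
  has_laplacian (fun y => h y ^+ p *: G y)
    (fun y => (- 2 * p%:R * h y ^+ p.+1) *: (G y *m (y - b)^T) + h y ^+ p *: K)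
    ((4 * p%:R * h x ^+ p.+1) *: ((p%:R - 1) *: G x - K *m (x - b))) x.
Proof.
move=> xb h G.
pose J y := (- 2 * p%:R * h y ^+ p.+1) *: (G y *m (y - b)^T) + h y ^+ p *: K.
have dG y v : is_derive y v G (K *m v).
  have -> : G = (fun y => K *m (y - b)) + cst u by [].
  apply: is_derive_eq; last exact: addr0.
  apply: is_deriveD; apply: is_derive_mulmx; exact: is_derive_subr.
have JE y v : J y *m v =
    (- 2 * p%:R * h y ^+ p.+1 * dot (y - b) v) *: G y + h y ^+ p *: (K *m v).
  by rewrite mulmxDl -2!scalemxAl mulmx_outer scalerA.
split.
  have nb : \forall y \near x, y != b by exact: near_neq.
  near=> y => v; rewrite JE; apply: is_derive_scale => //.
  by apply: is_derive_rsqVX; near: y.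
(* Leibniz expansion along [frame R i]. The two equal cross terms each sum to
   [- 2 p h^(p+1) K (x - b)]; the final 0 comes from the constant [K *m frame R i]. *)
exists (fun i => (- 2 * p%:R * ((- 2 * p.+1%:R * h x ^+ p.+2 * (x - b) i 0) * (x - b) i 0
    + h x ^+ p.+1)) *: G x
  + (- 2 * p%:R * h x ^+ p.+1 * (x - b) i 0) *: (K *m frame R i)
  + ((- 2 * p%:R * h x ^+ p.+1 * (x - b) i 0) *: (K *m frame R i) + 0)); split.
  move=> i.
  have -> : (fun y => J y *m frame R i) =
      (fun y => (- 2 * p%:R * (h y ^+ p.+1 * (y - b) i 0)) *: G y) +
      (fun y => h y ^+ p *: (K *m frame R i)).
    by apply/funext => y; rewrite JE dot_frame -[X in X *: _ + _]mulrA.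
  apply: is_deriveD; last first.
    have := is_derive_scale (is_derive_rsqVX p (frame R i) xb)
      (is_derive_cst (K *m frame R i) x (frame R i)).
    by rewrite dot_frame scaler0.
  rewrite -[X in _ + X *: _]mulrA; apply: is_derive_scale => //.
  have /is_derive_mxP/(_ i 0) dx := is_derive_subr b x (frame R i).
  have dh := is_derive_rsqVX p.+1 (frame R i) xb.
  apply: (is_derive_eq (is_deriveZ (- 2 * p%:R) (is_deriveM dh dx))).
  by rewrite dot_frame [frame R i i 0]mxE !eqxx /GRing.scale /=; ring.
rewrite !big_split /= big1_eq addr0 -addrA -mulr2n -scaler_suml.
have -> : \sum_i (- 2 * p%:R * h x ^+ p.+1 * (x - b) i 0) *: (K *m frame R i) =
    (- 2 * p%:R * h x ^+ p.+1) *: (K *m (x - b)).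
  under eq_bigr do rewrite -scalerA scalemxAr.
  by rewrite -scaler_sumr -mulmx_sumr sum_frame.
(* The Euclidean Laplacian of [|y - b|^(-2p)]: since [h |x - b|^2 = 1], the sum is
   [- 2 p (- 2 (p + 1) + 4) h^(p+1)]. *)
have -> : \sum_(i < 4) - 2 * p%:R * ((- 2 * p.+1%:R * h x ^+ p.+2 * (x - b) i 0) *
    (x - b) i 0 + h x ^+ p.+1) = 4 * p%:R * (p%:R - 1) * h x ^+ p.+1.
  rewrite -mulr_sumr big_split /= sumr_const card_ord.
  under eq_bigr do rewrite -mulrA.
  rewrite -mulr_sumr -/(dot (x - b) (x - b)) -/(rsq b x).
  have hr : h x * rsq b x = 1 by rewrite mulVf ?rsq_neq0.
  rewrite [h x ^+ p.+2]exprSr -[_ * (_ * h x) * _]mulrA -[_ * h x * _]mulrA hr.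
  by rewrite -mulr_natr -natr1; ring.
move: (G x) (K *m (x - b)) => g w.
by apply/colP => k; rewrite mulr2n !mxE; ring.
Unshelve. all: by end_near. Qed.

End Laplacian4.

(** * The bitension field of the Moebius maps *)

Section Inversion.
Context {R : realType}.
Implicit Types (a b x : 'cV[R]_4) (M : 'M[R]_4).

(* The tension field is [- sph * W] with [W] harmonic: [W x = M x] for [p = 0], and
   [W x = (1 + |b|^2) |x - b|^-4 M (x - b) + |x - b|^-2 M b] for [p = 1]. *)
Lemma bitension_inversion a b M (p : nat) x : (p <= 1)%N -> x != b ->
  bitension (spherical_metric R 3) (euclidean_metric R 3)
    (fun y => a + (rsq b y)^-1 ^+ p *: (M *m (y - b))) x =
  (2 * sph x) *: (M *m
    ((p%:R * sph b * (rsq b x)^-1 ^+ 2 + (1 - p%:R)) *: (x - b)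
     + (rsq b x)^-1 ^+ p *: b)).
Proof.
move=> p1 xb; set phi := (fun y => _).
pose h y := (rsq b y)^-1.
have phiE : phi = fun y => h y ^+ 0 *: (0 *m (y - b) + a) +
                           h y ^+ p *: (M *m (y - b) + 0).
  by apply/funext => y; rewrite /phi expr0 scale1r mul0mx add0r addr0.
(* The weights [p%:R] and [1 - p%:R] switch between the two cases, and each summand has the shape
   treated by [has_laplacian_inversion]. *)
pose W y := h y ^+ 2 *: ((p%:R * sph b) *: M *m (y - b) + 0)
  + (h y ^+ 0 *: ((1 - p%:R) *: M *m (y - b) + 0)
     + h y ^+ p *: (0 *m (y - b) + M *m b)).
have tauE y : y != b -> spherical_laplacian phi y = sph y *: - W y.
  move=> yb; rewrite phiE.
  have := has_laplacianD (has_laplacian_inversion 0 0 a yb)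
    (has_laplacian_inversion p M 0 yb).
  move=> /spherical_laplacianE ->.
  rewrite -/(h y) /W !mulmxDl -!(scalemxAl, mulmx_outer) !mul0mx !(addr0, add0r).
  have h0 : h y != 0 by rewrite invr_neq0 ?rsq_neq0.
  have rh : rsq b y = (h y)^-1 by rewrite invrK.
  (* Everything is recentred at [b]. In terms of [h y], [sph b], [dot (y - b) b], [M *m (y - b)] and
     [M *m b], the claim becomes a rational identity. *)
  have My : M *m y = M *m (y - b) + M *m b by rewrite -mulmxDr subrK.
  have dy : dot (y - b) y = (h y)^-1 + dot (y - b) b.
    by rewrite -rh -dotDr subrK.
  have sy : sph y = sph b + (h y)^-1 + 2 * dot (y - b) b.
    have yy : dot y y = dot (y - b) y + dot b y by rewrite -dotDl subrK.
    have by' : dot b y = dot (y - b) b + dot b b by rewrite -dotDl subrK dotC.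
    by rewrite /sph yy dy by'; ring.
  rewrite !mulmx_outer My dy sy.
  move: (M *m (y - b)) (M *m b) (dot (y - b) b) => w z d.
  move: (h y) (sph b) h0 => k c k0.
  apply/colP => i; case: p p1 {phi phiE W} => [|[|//]] _.
    by rewrite !mxE; ring.
  by rewrite !mxE; field.
(* The exponent 2 term is harmonic because its [G] equals [K *m (y - b)], the exponent 0 term
   because it is affine, and the last because [K = 0] and [p (p - 1) = 0]. *)
have [J WJ] : exists J, has_laplacian W J 0 x.
  eexists.
  have := has_laplacianD (has_laplacian_inversion 2 ((p%:R * sph b) *: M) 0 xb)
    (has_laplacianD (has_laplacian_inversion 0 ((1 - p%:R) *: M) 0 xb)
                    (has_laplacian_inversion p 0 (M *m b) xb)).
  congr has_laplacian.
  rewrite !mul0mx -!scalemxAl.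
  move: (M *m (x - b)) (M *m b) => w z.
  apply/colP => i; case: p p1 {phi phiE W tauE} => [|[|//]] _; rewrite !mxE; ring.
rewrite bitension_spherical_euclidean.
have -> : spherical_laplacian (spherical_laplacian phi) x = (2 * sph x) *: - W x.
  have NWJ : has_laplacian (fun y => - W y) (fun y => - J y) 0 x.
    by rewrite -oppr0; exact: has_laplacianN.
  rewrite -(spherical_laplacian_sph_harmonic NWJ).
  apply: spherical_laplacian_near; have nb := near_neq xb.
  by near=> y; apply: tauE; near: y.
rewrite scalerN opprK; congr (_ *: _).
rewrite /W [RHS]mulmxDr -!(scalemxAl, scalemxAr) mul0mx !(addr0, add0r) -/(h x).
move: (M *m (x - b)) (M *m b) => w z.
by apply/colP => i; rewrite !mxE; ring.
Unshelve. all: by end_near. Qed.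

(** An even exponent removes the square root in [enorm]; [p = 0, 1] give the two values of [eps]. *)
Lemma moebius_rsq a b alpha (A : 'M[R]_4) (p : nat) :
  moebius a b alpha A p.*2 =
  fun y => a + (rsq b y)^-1 ^+ p *: ((alpha *: A) *m (y - b)).
Proof.
apply/funext => y.
by rewrite /moebius -mul2n exprM enorm_sqr exprVn scalemxAl.
Qed.

End Inversion.

Theorem corollary5p3 (R : realType) (a b : 'cV[R]_4) (alpha : R)
    (A : 'M[R]_4) (eps : nat)
    (halpha : alpha <> 0) (hA : orthogonal_mx A)
    (heps : eps = 0%N \/ eps = 2%N) :
  ~ biharmonic_on (spherical_metric R 3) (euclidean_metric R 3)
      (moebius a b alpha A eps) (moebius_domain b eps).
Proof.
move=> biharm.
have [p [p1 epsE]] : exists p : nat, (p <= 1)%N /\ eps = p.*2.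
  by case: heps => ->; [exists 0%N|exists 1%N].
(* [A^T] is a left inverse of [A] and [alpha] is nonzero, so the linear part can be stripped from
   the bitension field. *)
have kerA u : (alpha *: A) *m u = 0 -> u = 0.
  move=> /eqP; rewrite -scalemxAl scaler_eq0 => /orP[/eqP //|/eqP Au].
  by rewrite -[u]mul1mx -hA -mulmxA Au mulmx0.
have zero x : x != b ->
    (p%:R * sph b * (rsq b x)^-1 ^+ 2 + (1 - p%:R)) *: (x - b)
     + (rsq b x)^-1 ^+ p *: b = 0.
  move=> xb; apply: kerA; apply/eqP.
  have : moebius_domain b eps x.
    by rewrite /moebius_domain; case: ifP => // _; exact/eqP.
  move=> /biharm; rewrite epsE moebius_rsq bitension_inversion// => /eqP.
  by rewrite scaler_eq0 mulf_eq0 (negPf (sph_neq0 x)) pnatr_eq0.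
pose e : 'cV[R]_4 := frame R 0.
have ee : dot e e = 1 by rewrite dot_frame mxE eqxx.
have e0 : e != 0 by rewrite -dot_self_eq0 ee oner_eq0.
case: p p1 epsE zero => [|[|//]] _ _ zero.
  (* For [p = 0] the vanishing vector is [x] itself. The point [b] is excluded, so both [e] and
     [- e] are at hand: one of them differs from [b]. *)
  have x0 x : x != b -> x = 0.
    move=> /zero; rewrite !(mul0r, subr0, add0r, expr0, scale1r).
    by rewrite subrK.
  have [be|be] := eqVneq e b; last by have /eqP := x0 _ be; rewrite (negPf e0).
  have : - e != b.
    rewrite -be -subr_eq0 -opprD oppr_eq0 -mulr2n -scaler_nat scaler_eq0.
    by rewrite pnatr_eq0 (negPf e0).
  by move=> /x0 /eqP; rewrite oppr_eq0 (negPf e0).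
(* At [x = b + u] all powers of [|x - b|] are 1. Subtracting the cases [u = e] and [u = - e]
   eliminates [b] and leaves [2 sph(b) e = 0], which is impossible. *)
have sum0 u : dot u u = 1 -> sph b *: u + b = 0.
  move=> uu; have bu : b + u - b = u by rewrite addrC addKr.
  have /zero : b + u != b by rewrite -subr_eq0 bu -dot_self_eq0 uu oner_eq0.
  by rewrite /rsq bu uu !(invr1, expr1n, mul1r, mulr1, subrr, addr0, scale1r).
have NeNe : dot (- e) (- e) = 1.
  by rewrite -ee; apply: eq_bigr => i _; rewrite [(- e) i 0]mxE mulrNN.
have /eqP : sph b *: e + b - (sph b *: - e + b) = 0 by rewrite !sum0// subrr.
rewrite scalerN opprD opprK addrACA subrr addr0 -mulr2n -scaler_nat.
by rewrite !scaler_eq0 pnatr_eq0 (negPf e0) (negPf (sph_neq0 b)).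
Qed.
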